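(* Let $A_1,\dots,A_n$ ($n\ge 2$) be agents in a communication network whose only initial entanglement between agents is pairwise entanglement in the form of EPR pairs, and let $G$ be their EPR graph. A pure $n$-partite maximally entangled state can be prepared amongst the $n$ agents (one qubit held by each agent) by local operations and classical communication if and only if $G$ is connected.
   Context: The EPR graph of $n$ agents $A_1,\dots,A_n$ is the undirected graph $G=(V,E)$ with $V=\{A_1,\dots,A_n\}$ and $\{A_i,A_j\}\in E$ ($i\ne j$) if and only if $A_i$ and $A_j$ share an EPR pair, i.e. each holds one qubit of a two-qubit system in the state $(|00\rangle+|11\rangle)/\sqrt{2}$. The initial joint state is the tensor product over the edges of $G$ of these EPR pairs, together with local ancilla qubits in state $|0\rangle$. A pure $n$-partite maximally entangled state is an $n$-qubit state obtained from $(|00\cdots0\rangle+|11\cdots1\rangle)/\sqrt{2}$ by applying single-qubit unitaries to the individual qubits. Local operations and classical communication (LOCC): each agent may adjoin ancillas, apply unitaries and perform measurements on the qubits it holds, conditioned on earlier outcomes and on received classical bits, and agents may exchange classical bits. There is no quantum communication after the EPR pairs have been distributed. A state is ''prepared'' if, for every sequence of measurement outcomes, at the end $n$ designated qubits, one per agent, are in that state (up to global phase, in tensor product with the remaining qubits). *)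

(* Defs.v *)
From HB Require Import structures.
From mathcomp Require Import all_boot all_order all_algebra.
From mathcomp Require Import complex spectral sesquilinear.
From mathcomp Require Import reals.

Set Implicit Arguments.
Unset Strict Implicit.
Unset Printing Implicit Defensive.

Import GRing.Theory Num.Theory.
Local Open Scope ring_scope.
Local Open Scope complex_scope.
Local Open Scope sesquilinear_scope.

(** * Registers of qubits

    The qubits of a register are the elements of a finite type [Q].  A pure
    state is its family of amplitudes in the computational basis, the basis
    vectors being labelled by the bit assignments [bits Q]. *)

Notation bits Q := {ffun Q -> bool}.

Section Registers.

Variable R : realType.
Local Notation C := R[i].

Definition state (Q : finType) := {ffun bits Q -> C}.

Definition ket (Q : finType) (x : bits Q) : state Q := [ffun y => (y == x)%:R].

Definition normalize (Q : finType) (psi : state Q) : state Q :=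
  (sqrtC (\sum_x `|psi x| ^+ 2))^-1 *: psi.

Definition restrict_bits (Q : finType) (P : pred Q) (x : bits Q) : bits {q | P q} :=
  [ffun q => x (val q)].

(** Operators on the qubits in [P] are matrices indexed, through [enum_rank],
    by the bit assignments to these qubits. *)
Definition operator (Q : finType) (P : pred Q) := 'M[C]_#|{: bits {q | P q}}|.

(** [(M (x) 1) psi]: [M] acts on the qubits in [P], the identity on the others,
    so that only the assignments [y] agreeing with [x] outside [P] contribute. *)
Definition apply_on (Q : finType) (P : pred Q) (M : operator P)
    (psi : state Q) : state Q :=
  [ffun x : bits Q => \sum_(y : bits Q | [forall q, ~~ P q ==> (y q == x q)])
     M (enum_rank (restrict_bits P x)) (enum_rank (restrict_bits P y)) * psi y].

(** * Maximally entangled states of [n] qubits *)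

Definition ghz (n : nat) : state 'I_n :=
  (sqrtC 2)^-1 *: (ket [ffun=> false] + ket [ffun=> true]).

Definition apply_single_qubit (n : nat) (U : 'I_n -> 'M[C]_2)
    (psi : state 'I_n) : state 'I_n :=
  [ffun x : bits 'I_n => \sum_(y : bits 'I_n)
     (\prod_i U i (inord (x i)) (inord (y i))) * psi y].

Definition maximally_entangled (n : nat) (psi : state 'I_n) : Prop :=
  exists U : 'I_n -> 'M[C]_2,
    (forall i, U i \is unitarymx) /\ psi = apply_single_qubit U (ghz n).

End Registers.

(** * The initial state attached to an EPR graph

    The agents are the elements of ['I_n] and [e] is the edge relation of the
    EPR graph.  It is used for symmetric irreflexive [e] only, so each edge is
    represented by the pair of its endpoints in increasing order. *)

Definition edge (n : nat) (e : rel 'I_n) :=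
  {p : 'I_n * 'I_n | (p.1 < p.2)%N && e p.1 p.2}.

(** Two qubits per edge, and [anc i] ancillas for each agent [i]. *)
Definition qubit (n : nat) (e : rel 'I_n) (anc : 'I_n -> nat) : finType :=
  ((edge e * bool) + {i : 'I_n & 'I_(anc i)})%type.

Definition holder (n : nat) (e : rel 'I_n) (anc : 'I_n -> nat)
    (q : qubit e anc) : 'I_n :=
  match q with
  | inl (p, false) => (val p).1
  | inl (p, true) => (val p).2
  | inr a => tag a
  end.

Definition held_by (n : nat) (e : rel 'I_n) (anc : 'I_n -> nat) (i : 'I_n) :
    pred (qubit e anc) :=
  fun q => holder q == i.

Definition epr_amplitude (R : realType) (a b : bool) : R[i] :=
  (sqrtC 2)^-1 * (a == b)%:R.

Definition initial_state (R : realType) (n : nat) (e : rel 'I_n)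
    (anc : 'I_n -> nat) : state R (qubit e anc) :=
  [ffun x : bits (qubit e anc) => (\prod_(p : edge e)
                epr_amplitude R (x (inl (p, false))) (x (inl (p, true)))) *
             \prod_(a : {i : 'I_n & 'I_(anc i)}) (x (inr a) == false)%:R].

(** * Local operations and classical communication *)

(** What an agent may have learnt: a measurement outcome of its own, or a bit
    string received from some agent. *)
Inductive event (n : nat) : Type :=
| Outcome of nat
| Message of 'I_n & seq bool.

Definition memory (n : nat) := seq (event n).

Section LOCC.

Variables (R : realType) (n : nat) (e : rel 'I_n) (anc : 'I_n -> nat).
Local Notation Q := (qubit e anc).
Local Notation local_operator i := (operator R (@held_by n e anc i)).

(** Measurements are general: finitely many measurement operators subject to
    the completeness relation. *)
Inductive action (i : 'I_n) : Type :=
| Unitary (U : local_operator i) of U \is unitarymx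
| Measure (k : nat) (M : 'I_k -> local_operator i)
    of \sum_o (M o)^t* *m M o = 1%:M
| Send of 'I_n & seq bool.

(** The sequence of acting agents is fixed in advance (this is no restriction,
    since an agent may apply the identity), but what an agent does is a function
    of its own memory, and of nothing else. *)
Definition instruction := {i : 'I_n & memory n -> action i}.

Definition protocol := seq instruction.

Record config := Config {
  quantum : state R Q;
  classical : 'I_n -> memory n
}.

Definition record_event (i : 'I_n) (ev : event n) (mem : 'I_n -> memory n) :
    'I_n -> memory n :=
  fun j => if j == i then rcons (mem j) ev else mem j.

(** [perform a c c']: performing [a] in [c] leads to [c'] with positive
    probability. *)
Definition perform (i : 'I_n) (a : action i) (c c' : config) : Prop :=
  match a with
  | Unitary U _ => c' = Config (apply_on U (quantum c)) (classical c)
  | Measure k M _ =>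
      exists o : 'I_k,
        apply_on (M o) (quantum c) != 0 /\
        c' = Config (normalize (apply_on (M o) (quantum c)))
                    (record_event i (Outcome n o) (classical c))
  | Send j m =>
      c' = Config (quantum c) (record_event j (Message i m) (classical c))
  end.

Fixpoint run (P : protocol) (c c' : config) : Prop :=
  match P with
  | [::] => c' = c
  | s :: P' =>
      exists c1, perform (tagged s (classical c (tag s))) c c1 /\ run P' c1 c'
  end.

Definition initial_config : config :=
  Config (initial_state R e anc) (fun=> [::]).

(** The designated qubits [d i] are in state [t], in tensor product with the
    remaining qubits.  A global phase is absorbed in [phi]. *)
Definition designated_in_state (d : 'I_n -> Q) (t : state R 'I_n)
    (psi : state R Q) : Prop :=
  exists phi : state R {q : Q | q \notin codom d},
    forall x : bits Q,
      psi x = t [ffun i => x (d i)] *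
              phi (restrict_bits (fun q => q \notin codom d) x).

End LOCC.

Definition locc_preparable (R : realType) (n : nat) (e : rel 'I_n)
    (t : state R 'I_n) : Prop :=
  exists (anc : 'I_n -> nat) (P : protocol R e anc) (d : 'I_n -> qubit e anc),
    (forall i, holder (d i) = i) /\
    (forall c, run P (initial_config R e anc) c ->
       designated_in_state d t (quantum c)).

Definition connected_graph (n : nat) (e : rel 'I_n) : Prop :=
  forall i j, connect e i j.

(* Main.v *)
Require Import Defs.
From mathcomp Require Import all_boot all_order all_algebra.
From mathcomp Require Import complex spectral sesquilinear.
From mathcomp Require Import reals.

(** If the graph is disconnected, cut it along a connected component [S].  The
    initial state is a product across this cut, local operations and
    postselected measurements keep it so, and GHZ states are not products.

    If the graph is connected, start from the EPR pair of one edge, a GHZ state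
    on its two endpoints, and let the set [T] of agents sharing a GHZ state
    grow along edges [vw] with [v] in [T] and [w] not in [T]: [v] measures the
    parity [m] of its GHZ qubit and its half of the pair [vw], resets this half,
    and sends [m] to [w], who flips the other half if [m = 1].  No ancilla is
    needed. *)

Set Implicit Arguments.
Unset Strict Implicit.
Unset Printing Implicit Defensive.

Import GRing.Theory Num.Theory.
Local Open Scope ring_scope.
Local Open Scope complex_scope.
Local Open Scope sesquilinear_scope.

(** * Operators acting on some qubits of a register, and product states across a cut *)

Section LocalOperators.

Variables (R : realType) (Q : finType).
Local Notation C := R[i].
Implicit Types (P S : pred Q) (x y : bits Q) (psi : state R Q).

(** Parametrises the assignments agreeing with [x] outside [P] by the assignments to [P]; this turns
    the constrained sum of [apply_on] into a sum over a full type. *)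
Definition overwrite P x (z : bits {q | P q}) : bits Q :=
  [ffun q => if insub q is Some s then z s else x q].

Lemma overwrite_in P x z (s : {q | P q}) : overwrite x z (val s) = z s.
Proof. by rewrite ffunE valK. Qed.

Lemma overwrite_out P x (z : bits {q | P q}) q : ~~ P q -> overwrite x z q = x q.
Proof. by move=> Pq; rewrite ffunE insubF //; apply/negbTE. Qed.

Lemma restrict_overwrite P x (z : bits {q | P q}) :
  restrict_bits P (overwrite x z) = z.
Proof. by apply/ffunP=> s; rewrite ffunE overwrite_in. Qed.

Lemma overwrite_overwrite P x (z w : bits {q | P q}) :
  overwrite (overwrite x z) w = overwrite x w.
Proof.
apply/ffunP=> q; case Pq: (P q); last by rewrite !overwrite_out ?Pq.
by rewrite -[q]/(val (Sub q Pq : {q | P q})) !overwrite_in.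
Qed.

Lemma overwrite_restrict P x : overwrite x (restrict_bits P x) = x.
Proof.
apply/ffunP=> q; case Pq: (P q); last by rewrite !overwrite_out ?Pq.
by rewrite -[q]/(val (Sub q Pq : {q | P q})) !overwrite_in ffunE.
Qed.

Lemma apply_onE P (M : operator R P) psi x :
  apply_on M psi x = \sum_(z : bits {q | P q})
     M (enum_rank (restrict_bits P x)) (enum_rank z) * psi (overwrite x z).
Proof.
rewrite ffunE (reindex_onto (overwrite x) (restrict_bits P)) /=.
  apply: eq_big => [z|z _]; last by rewrite restrict_overwrite.
  rewrite restrict_overwrite eqxx andbT; apply/forallP=> q; apply/implyP=> Pq.
  by rewrite overwrite_out.
move=> y /forallP xy; apply/ffunP=> q; case Pq: (P q).
  by rewrite -[q]/(val (Sub q Pq : {q | P q})) !overwrite_in ffunE.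
by rewrite overwrite_out ?Pq //; apply/esym/eqP/(implyP (xy q)); rewrite Pq.
Qed.

Lemma apply_on_mul P (A B : operator R P) psi :
  apply_on (A *m B) psi = apply_on A (apply_on B psi).
Proof.
apply/ffunP=> x; rewrite !apply_onE.
under [RHS]eq_bigr => z _.
  rewrite apply_onE restrict_overwrite mulr_sumr.
  under eq_bigr => w _ do rewrite overwrite_overwrite mulrA.
  over.
rewrite exchange_big; apply: eq_bigr => w _ /=; rewrite -mulr_suml; congr (_ * _).
by rewrite mxE (reindex enum_rank) //=; apply/onW_bij/enum_rank_bij.
Qed.

Lemma apply_on1 P psi : apply_on (1%:M : operator R P) psi = psi.
Proof.
apply/ffunP=> x; rewrite apply_onE (bigD1 (restrict_bits P x)) //=.
rewrite mxE eqxx mul1r overwrite_restrict big1 ?addr0 // => z zx.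
by rewrite mxE (inj_eq enum_rank_inj) eq_sym (negbTE zx) mul0r.
Qed.

Lemma apply_on_sum P (I : finType) (M : I -> operator R P) psi :
  apply_on (\sum_i M i) psi = \sum_i apply_on (M i) psi.
Proof.
apply/ffunP=> x; rewrite apply_onE sum_ffunE.
under [RHS]eq_bigr => i _ do rewrite apply_onE.
rewrite exchange_big; apply: eq_bigr => z _.
by rewrite summxE mulr_suml.
Qed.

Lemma apply_on0 P (M : operator R P) : apply_on M 0 = 0.
Proof.
by apply/ffunP=> x; rewrite apply_onE ffunE big1 // => z _; rewrite ffunE mulr0.
Qed.

Lemma apply_unitary_neq0 P (U : operator R P) psi :
  U \is unitarymx -> psi != 0 -> apply_on U psi != 0.
Proof.
move=> /unitarymxP /mulmx1C UU; apply: contraNneq => Upsi.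
by rewrite -[psi](@apply_on1 P) -UU apply_on_mul Upsi apply_on0.
Qed.

(** If every [M o] killed [psi], the completeness relation would give [psi = 0]. Hence a run never
    gets stuck at a measurement. *)
Lemma measurement_outcome_exists P k (M : 'I_k -> operator R P) psi :
  \sum_o (M o)^t* *m M o = 1%:M -> psi != 0 -> exists o, apply_on (M o) psi != 0.
Proof.
move=> MM psi0; apply/existsP; apply: contraNT psi0 => /existsPn all0.
rewrite -[psi](@apply_on1 P) -MM apply_on_sum big1 // => o _.
by rewrite apply_on_mul (eqP (negbNE (all0 o))) apply_on0.
Qed.

Lemma normalize_neq0 psi : psi != 0 -> normalize psi != 0.
Proof.
move=> psi0; rewrite /normalize scaler_eq0 negb_or psi0 andbT invr_eq0 sqrtC_eq0.
apply: contraNneq psi0 => /eqP; rewrite psumr_eq0 => [/allP all0|x _]; last first.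
  by rewrite exprn_ge0.
apply/eqP/ffunP=> x; rewrite ffunE; apply/eqP.
by have /= := all0 x (mem_index_enum x); rewrite expf_eq0 /= normr_eq0.
Qed.

Definition mix S x y : bits Q := [ffun q => if S q then x q else y q].

Lemma mixC S x y : mix (predC S) x y = mix S y x.
Proof. by apply/ffunP=> q; rewrite !ffunE /=; case: (S q). Qed.

(** Vanishing of all 2x2 minors of the amplitude matrix of the cut: [psi] is a
    product of a state of the qubits in [S] and a state of the others. *)
Definition product_across S psi :=
  forall x y, psi x * psi y = psi (mix S x y) * psi (mix S y x).

Lemma product_acrossC S psi : product_across S psi -> product_across (predC S) psi.
Proof. by move=> Spsi x y; rewrite !mixC mulrC (Spsi y x). Qed.

Lemma eq_product_across S S' psi :
  S =1 S' -> product_across S psi -> product_across S' psi.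
Proof.
move=> SS Spsi x y.
have eq_mix u v : mix S' u v = mix S u v by apply/ffunP=> q; rewrite !ffunE SS.
by rewrite !eq_mix.
Qed.

Lemma product_across_scale S a psi :
  product_across S psi -> product_across S (a *: psi).
Proof. by move=> Spsi x y; rewrite !ffunE mulrACA Spsi mulrACA. Qed.

(** Both sides are double sums over assignments [z], [w] to [P], equal term by term: as [P] lies in
    [S], mixing keeps the matrix entries and commutes with overwriting. *)
Lemma product_across_apply_in S P (M : operator R P) psi :
  {subset P <= S} -> product_across S psi -> product_across S (apply_on M psi).
Proof.
move=> PS Spsi x y; rewrite !apply_onE !big_distrlr /=.
have restrict_mix x1 y1 : restrict_bits P (mix S x1 y1) = restrict_bits P x1.
  by apply/ffunP=> s; rewrite !ffunE [S _](PS _ (valP s)).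
have mix_overwrite x1 y1 (z w : bits {q | P q}) :
    overwrite (mix S x1 y1) z = mix S (overwrite x1 z) (overwrite y1 w).
  apply/ffunP=> q; rewrite ffunE [RHS]ffunE; case: insubP => [s _ <-|Pq].
    by rewrite [S _](PS _ (valP s)) overwrite_in.
  by rewrite !overwrite_out // ffunE.
apply: eq_bigr => z _; apply: eq_bigr => w _; rewrite !restrict_mix.
by rewrite mulrACA Spsi (mix_overwrite _ _ z w) (mix_overwrite _ _ w z) mulrACA.
Qed.

Lemma product_across_apply S P (M : operator R P) psi :
  {subset P <= S} \/ {subset P <= predC S} ->
  product_across S psi -> product_across S (apply_on M psi).
Proof.
case=> [PS|PS] Spsi; first exact: product_across_apply_in.
apply: eq_product_across (product_acrossC _) => [q /=|]; first exact: negbK.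
by apply: product_across_apply_in PS _; apply: product_acrossC.
Qed.

End LocalOperators.

(** * Local unitaries and the entanglement of GHZ states across every cut *)

Section GHZ.

Variables (R : realType) (n : nat).
Local Notation C := R[i].
Implicit Types (S : pred 'I_n) (x y : bits 'I_n) (psi : state R 'I_n).

Lemma sum_bool_ord2 (F : 'I_2 -> C) : \sum_(b : bool) F (inord b) = \sum_i F i.
Proof.
rewrite big_bool !big_ord_recl big_ord0 addr0 addrC.
by congr (F _ + F _); apply/val_inj; rewrite /= inordK.
Qed.

(** Products of tensor products: a product over qubits of sums over one bit expands into a sum over
    intermediate assignments. *)
Lemma apply_single_qubit_mul (U V : 'I_n -> 'M[C]_2) psi :
  apply_single_qubit V (apply_single_qubit U psi)
  = apply_single_qubit (fun i => V i *m U i) psi.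
Proof.
apply/ffunP=> x; rewrite !ffunE.
transitivity (\sum_(y : bits 'I_n) \sum_(z : bits 'I_n)
    \prod_i (V i (inord (x i)) (inord (y i)) * U i (inord (y i)) (inord (z i)))
    * psi z).
  apply: eq_bigr => y _; rewrite ffunE mulr_sumr; apply: eq_bigr => z _.
  by rewrite mulrA -big_split.
rewrite exchange_big; apply: eq_bigr => z _ /=; rewrite -mulr_suml; congr (_ * _).
under [RHS]eq_bigr => i _ do rewrite mxE -sum_bool_ord2.
by rewrite bigA_distr_bigA.
Qed.

Lemma apply_single_qubit1 psi : apply_single_qubit (fun=> 1%:M) psi = psi.
Proof.
have inord_inj : injective (fun b : bool => inord b : 'I_2).
  by move=> b c /(congr1 val); rewrite /= !inordK; case: b; case: c.
apply/ffunP=> x; rewrite ffunE (bigD1 x) //= big1 ?mul1r => [|i _]; last first.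
  by rewrite mxE eqxx.
rewrite big1 ?addr0 // => y yx.
have [i xyi] : exists i, x i != y i.
  apply/existsP; apply: contraNT yx => /existsPn xy; apply/eqP/ffunP=> i.
  by apply/esym/eqP/negbNE.
by rewrite (bigD1 i) //= mxE (inj_eq inord_inj) (negbTE xyi) !mul0r.
Qed.

(** Exchanging [z] and [w] outside [S] is an involution on the pairs of summation indices, and it
    matches the two double sums term by term. *)
Lemma product_across_single_qubit S (U : 'I_n -> 'M[C]_2) psi :
  product_across S psi -> product_across S (apply_single_qubit U psi).
Proof.
move=> Spsi x y; rewrite !ffunE !big_distrlr /= !pair_big.
pose swap (p : bits 'I_n * bits 'I_n) := (mix S p.1 p.2, mix S p.2 p.1).
have swapK : involutive swap.
  by case=> z w; congr pair; apply/ffunP=> i; rewrite !ffunE; case: (S i).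
rewrite [RHS](reindex_inj (inv_inj swapK)) /=; apply: eq_bigr => -[z w] _ /=.
rewrite mulrACA Spsi [RHS]mulrACA; congr (_ * _); rewrite -!big_split.
by apply: eq_bigr => i _ /=; rewrite !ffunE; case: (S i) => //; rewrite mulrC.
Qed.

Lemma ghzE x : ghz R n x =
  (sqrtC 2)^-1 * ((x == [ffun=> false])%:R + (x == [ffun=> true])%:R).
Proof. by rewrite !ffunE. Qed.

(** The all-zero and all-one assignments have nonzero amplitudes, but a mixture of them takes
    different values at [i] and [j], so its amplitude vanishes. *)
Lemma ghz_not_product S i j : S i -> ~~ S j -> ~ product_across S (ghz R n).
Proof.
move=> Si Sj /(_ [ffun=> false] [ffun=> true]) /eqP; rewrite !ghzE !eqxx.
have neq x y k : x k != y k -> (x == y) = false.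
  by apply: contraNF => /eqP ->.
rewrite (neq _ [ffun=> true] i) ?ffunE // (neq [ffun=> true] _ i) ?ffunE //.
rewrite (neq (mix S _ _) _ j) ?ffunE ?(negbTE Sj) ?ffunE //.
rewrite (neq (mix S _ _) _ i) ?ffunE ?Si ?ffunE //.
by rewrite !(addr0, add0r, mulr0, mulr1, mul0r) mulf_eq0 invr_eq0 sqrtC_eq0 pnatr_eq0.
Qed.

Lemma ghz_maximally_entangled : maximally_entangled (ghz R n).
Proof.
exists (fun=> 1%:M); rewrite apply_single_qubit1; split=> // i.
by apply/unitarymxP; rewrite mul1mx trmx1 map_mx1.
Qed.

(** The adjoints of the local unitaries preserve products and carry [t] back to the GHZ state. *)
Lemma maximally_entangled_not_product S i j (t : state R 'I_n) :
  maximally_entangled t -> S i -> ~~ S j -> ~ product_across S t.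
Proof.
move=> [U [Uu ->]] Si Sj.
move=> /(product_across_single_qubit (fun i => (U i)^t*)).
rewrite apply_single_qubit_mul; suff -> : apply_single_qubit (fun i => (U i)^t* *m U i)
   (ghz R n) = ghz R n by exact: ghz_not_product Si Sj.
rewrite -[RHS]apply_single_qubit1; apply/ffunP=> x; rewrite !ffunE.
apply: eq_bigr => y _; congr (_ * _); apply: eq_bigr => k _.
by have /unitarymxP/mulmx1C -> := Uu k.
Qed.

End GHZ.

(** * Necessity: product form across a cut that no EPR pair crosses *)

Section Necessity.

Variables (R : realType) (n : nat) (e : rel 'I_n) (anc : 'I_n -> nat).
Local Notation Q := (qubit e anc).

Variable S : pred 'I_n.
Hypothesis S_closed : forall i j, e i j -> S i = S j.

Local Notation SQ := (fun q : Q => S (holder q)).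

(** Every factor of the amplitude lives on one side of the cut: an edge has both ends in [S] or both
    outside, and an ancilla has a single holder. *)
Lemma initial_state_product : product_across SQ (initial_state R e anc).
Proof.
move=> x y; rewrite !ffunE mulrACA [RHS]mulrACA -!big_split; congr (_ * _).
  apply: eq_bigr => p _ /=; rewrite !ffunE /=.
  have /andP[_ /S_closed ->] := valP p.
  by case: (S _) => //; rewrite mulrC.
apply: eq_bigr => a _ /=; rewrite !ffunE /=.
by case: (S _) => //; rewrite mulrC.
Qed.

Lemma initial_state_neq0 : initial_state R e anc != 0.
Proof.
apply/eqP => /ffunP/(_ [ffun=> false])/eqP; rewrite !ffunE; apply/negP.
rewrite mulf_neq0 //; apply/prodf_neq0 => ? _; rewrite !ffunE ?eqxx ?oner_neq0 //.
by rewrite /epr_amplitude mulr1 invr_eq0 sqrtC_eq0 pnatr_eq0.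
Qed.

Lemma local_operator_product i (M : operator R (@held_by n e anc i)) psi :
  product_across SQ psi -> product_across SQ (apply_on M psi).
Proof.
apply: product_across_apply; case Si: (S i); [left|right] => q /eqP qi;
  by rewrite unfold_in /= qi Si.
Qed.

(** One branch is enough, since preparation constrains all runs. Nonvanishing is carried along so
    that each measurement has a possible outcome. *)
Lemma run_product (P : protocol R e anc) c :
  quantum c != 0 -> product_across SQ (quantum c) ->
  exists2 c', run P c c' & quantum c' != 0 /\ product_across SQ (quantum c').
Proof.
elim: P c => [|[i a] P IH] c c0 cS; first by exists c.
suff [c1 step [c10 c1S]] : exists2 c1, perform (a (classical c i)) c c1
    & quantum c1 != 0 /\ product_across SQ (quantum c1).
  by have [c' runP ?] := IH _ c10 c1S; exists c' => //; exists c1.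
case: (a (classical c i)) => [U Uu|k M MM|j m] /=.
- eexists; first by [].
  by split; [exact: apply_unitary_neq0 | exact: local_operator_product].
- have [o o0] := measurement_outcome_exists MM c0.
  eexists; first by exists o.
  split; first exact: normalize_neq0.
  by apply: product_across_scale; apply: local_operator_product.
- by eexists.
Qed.

(** With the other qubits frozen at an assignment [x0] of nonzero amplitude, [psi] is a nonzero
    multiple of [t]. Mixing respects this embedding because [d i] is held by [i]. *)
Lemma designated_product (d : 'I_n -> Q) (t : state R 'I_n) (psi : state R Q) :
  (forall i, holder (d i) = i) -> designated_in_state d t psi ->
  psi != 0 -> product_across SQ psi -> product_across S t.
Proof.
move=> dK [phi psiE] psi0 psiS.
have d_inj : injective d := can_inj dK.
have [x0 x00] : exists x, psi x != 0.
  apply/existsP; apply: contraNT psi0 => /existsPn psi0.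
  by apply/eqP/ffunP=> x; rewrite ffunE; apply/eqP/negbNE.
pose ext (a : bits 'I_n) : bits Q :=
  [ffun q => if q \in codom d then a (holder q) else x0 q].
have psi_ext a :
    psi (ext a) = t a * phi (restrict_bits (fun q => q \notin codom d) x0).
  rewrite psiE; congr (t _ * phi _); apply/ffunP => q; rewrite !ffunE.
    by rewrite codom_f dK.
  by rewrite (negbTE (valP q)).
have mix_ext a b : mix SQ (ext a) (ext b) = ext (mix S a b).
  by apply/ffunP=> q; rewrite !ffunE; case: ifP => //; case: ifP.
move=> a b; have := psiS (ext a) (ext b); rewrite !mix_ext !psi_ext.
rewrite mulrACA [RHS]mulrACA => /mulIf; apply.
by move: x00; rewrite psiE mulf_eq0 negb_or => /andP[_ phi0]; rewrite mulf_neq0.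
Qed.

End Necessity.

Lemma preparable_connected (R : realType) (n : nat) (e : rel 'I_n)
    (t : state R 'I_n) :
  symmetric e -> maximally_entangled t -> locc_preparable e t -> connected_graph e.
Proof.
move=> e_sym t_max [anc [P [d [dK Pt]]]] i j; apply/negPn/negP => ij.
(* The cut is the connected component of [i], which [j] lies outside. *)
have S_closed k l : e k l -> connect e i k = connect e i l.
  by move=> kl; apply: (same_connect1r (sym_connect_sym e_sym) kl).
have [c runP [c0 cS]] := run_product P (c := initial_config R e anc)
  (initial_state_neq0 _ _ _) (initial_state_product R S_closed).
apply: (maximally_entangled_not_product t_max (connect0 e i) ij).
exact: designated_product dK (Pt c runP) c0 cS.
Qed.

(** * Operators given by substitutions on basis states: bit flip and fusion *)

Section Substitutions.

Variables (R : realType) (Q : finType).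
Implicit Types (x : bits Q).

Definition set_bit (T : finType) (x : bits T) q (a : bool) : bits T :=
  [ffun q' => if q' == q then a else x q'].

Lemma overwrite_set_bit (P : pred Q) x (s : {q | P q}) a :
  overwrite x (set_bit (restrict_bits P x) s a) = set_bit x (val s) a.
Proof.
apply/ffunP=> q; rewrite !ffunE; case: insubP => [s' Ps' <-|Pq].
  by rewrite !ffunE (inj_eq val_inj).
by case: eqP => // qs; rewrite qs (valP s) in Pq.
Qed.

(** Sends the basis state [g z] to the sum of the basis states [z] such that
    [b z], that is [psi] to [z |-> b z * psi (g z)]. *)
Definition subst_operator (P : pred Q) (b : pred (bits {q | P q}))
    (g : bits {q | P q} -> bits {q | P q}) : operator R P :=
  \matrix_(i, j) (b (enum_val i) && (enum_val j == g (enum_val i)))%:R.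

Lemma apply_subst_operator (P : pred Q) b g (psi : state R Q) x :
  apply_on (@subst_operator P b g) psi x =
  (b (restrict_bits P x))%:R * psi (overwrite x (g (restrict_bits P x))).
Proof.
rewrite apply_onE (bigD1 (g (restrict_bits P x))) //= big1 => [|z zg].
  by rewrite addr0 mxE !enum_rankK eqxx andbT.
by rewrite mxE !enum_rankK (negbTE zg) andbF mul0r.
Qed.

(** Stacked over the outcomes, the operators send the basis state [y] to the basis state [h y]. The
    hypothesis makes [h] injective, so the stack is an isometry. *)
Lemma subst_operators_complete (P : pred Q) k
    (b : 'I_k -> pred (bits {q | P q}))
    (g : 'I_k -> bits {q | P q} -> bits {q | P q})
    (h : bits {q | P q} -> 'I_k * bits {q | P q}) :
  (forall o z y, (b o z && (y == g o z)) = ((o, z) == h y)) ->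
  \sum_o (subst_operator (b o) (g o))^t* *m subst_operator (b o) (g o) = 1%:M.
Proof.
move=> bgh.
have h_inj : injective h.
  move=> y y'; case hy: (h y) => [o z] hy'.
  have /andP[_ /eqP ->] : b o z && (y == g o z) by rewrite bgh hy.
  by have /andP[_ /eqP ->] : b o z && (y' == g o z) by rewrite bgh -hy'.
apply/matrixP=> i j; rewrite summxE [RHS]mxE.
rewrite -(inj_eq enum_val_inj) -(inj_eq h_inj).
transitivity (\sum_o \sum_(z : bits {q | P q})
    ((o, z) == h (enum_val i))%:R * ((o, z) == h (enum_val j))%:R : R[i]).
  apply: eq_bigr => o _; rewrite mxE (reindex enum_rank) /=; last first.
    exact/onW_bij/enum_rank_bij.
  by apply: eq_bigr => z _; rewrite !mxE !enum_rankK !bgh conjC_nat.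
rewrite pair_big (bigD1 (h (enum_val i))) //= -surjective_pairing eqxx mul1r.
rewrite big1 ?addr0 // => -[o z] /= /negbTE ->.
by rewrite mul0r.
Qed.

Variables (P : pred Q) (s s' : {q | P q}).

Definition flip_operator (m : bool) : operator R P :=
  subst_operator predT (fun z => set_bit z s (z s (+) m)).

(** A flip is its own inverse on basis states, hence a complete family with a single outcome. *)
Lemma flip_operator_unitary m : flip_operator m \is unitarymx.
Proof.
have := @subst_operators_complete P 1 (fun=> predT)
  (fun=> fun z => set_bit z s (z s (+) m))
  (fun y => (ord0, set_bit y s (y s (+) m))).
rewrite big_ord1 => complete; apply/unitarymxP/mulmx1C; apply: complete => o z y.
rewrite /= xpair_eqE [o]ord1 eqxx; apply/eqP/eqP => ->;
  by apply/ffunP=> q; rewrite !ffunE eqxx; case: eqP => // ->; rewrite addbK.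
Qed.

Lemma apply_flip m psi x :
  apply_on (flip_operator m) psi x = psi (set_bit x (val s) (x (val s) (+) m)).
Proof.
by rewrite apply_subst_operator mul1r ffunE overwrite_set_bit.
Qed.

(** Parity measurement of [s] and [s'], followed by a reset of [s'] to 0. *)
Definition fuse_operator (o : 'I_2) : operator R P :=
  subst_operator (fun z => ~~ z s') (fun z => set_bit z s' (z s (+) odd o)).

Lemma fuse_operators_complete : s != s' ->
  \sum_o (fuse_operator o)^t* *m fuse_operator o = 1%:M.
Proof.
(* The inverse map sends [y] to the parity of its two bits and to [y] with [s'] reset; since the bit
   at [s] survives, the parity restores the bit at [s']. *)
move=> ss'; apply: (@subst_operators_complete P 2 (fun=> fun z => ~~ z s')
  (fun o z => set_bit z s' (z s (+) odd o))
  (fun y => (inord (y s (+) y s'), set_bit y s' false))) => o z y.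
rewrite /= xpair_eqE; apply/andP/andP => [[zs' /eqP ->]|[/eqP -> /eqP ->]].
  rewrite !ffunE eqxx (negbTE ss') addKb; split.
    by apply/eqP/val_inj; rewrite /= inordK; case: o => [[|[]]].
  apply/eqP/ffunP=> q; rewrite !ffunE; case: eqP => // ->.
  exact: negbTE.
rewrite !ffunE eqxx (negbTE ss'); split=> //.
apply/eqP/ffunP=> q; rewrite !ffunE; case: eqP => // ->.
by rewrite inordK ?oddb ?addKb //; case: (_ (+) _).
Qed.

Lemma apply_fuse o psi x : apply_on (fuse_operator o) psi x =
  (~~ x (val s'))%:R * psi (set_bit x (val s') (x (val s) (+) odd o)).
Proof. by rewrite apply_subst_operator !ffunE overwrite_set_bit. Qed.

End Substitutions.

(** * Sufficiency: growing a GHZ state along edges *)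

Section Sufficiency.

Variables (R : realType) (n : nat) (e : rel 'I_n).
Local Notation anc := (fun _ : 'I_n => 0).
Local Notation Q := (qubit e anc).
Local Notation half p b := (inl (p, b) : Q).
Implicit Types (T : {set 'I_n}) (d : 'I_n -> Q) (p : edge e) (x : bits Q).

Definition internal T p := ((val p).1 \in T) && ((val p).2 \in T).

(** The value [true] on ancillas is a default, [anc] being zero. *)
Definition within T (q : Q) := if q is inl (p, _) then internal T p else true.

(** Placing each [d i] on an edge inside [T] keeps it apart from the EPR pairs that leave [T]. *)
Definition anchored T d := forall i, i \in T -> holder (d i) = i /\ within T (d i).

Definition agree T d x := [forall i in T, forall j in T, x (d i) == x (d j)].

Definition matched (E : pred (edge e)) x :=
  [forall (p | E p), x (half p false) == x (half p true)].

(** A GHZ state on the qubits [d i], [i \in T], times EPR pairs on all edges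
    leaving or avoiding [T], times a basis-diagonal state of everything else. *)
Definition ghz_on T d (psi : state R Q) :=
  exists a (B : pred (bits Q)),
    (forall x y : bits Q,
       (forall q, within T q -> q \notin d @: T -> x q = y q) -> B x = B y) /\
    forall x, psi x = a *
      [&& agree T d x, matched (predC (internal T)) x & B x]%:R.

Lemma internal_half T p b :
  internal T p = (holder (half p b) \in T) && (holder (half p (~~ b)) \in T).
Proof. by case: b => //=; rewrite andbC. Qed.

Lemma matched_half (E : pred (edge e)) x p b :
  matched E x -> E p -> x (half p b) = x (half p (~~ b)).
Proof. by move=> /forallP/(_ p)/implyP Ex /Ex /eqP; case: b. Qed.

Lemma edge_halves v w : symmetric e -> irreflexive e -> e v w ->
  exists p b, holder (half p b) = v /\ holder (half p (~~ b)) = w.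
Proof.
move=> e_sym e_irr vw; case: (ltngtP v w) => [lt_vw|lt_wv|/val_inj eq_vw].
- have pP : (((v, w).1 < (v, w).2)%N && e (v, w).1 (v, w).2) by rewrite lt_vw.
  by exists (Sub (v, w) pP), false.
- have pP : (((w, v).1 < (w, v).2)%N && e (w, v).1 (w, v).2) by rewrite lt_wv e_sym.
  by exists (Sub (w, v) pP), true.
- by rewrite eq_vw e_irr in vw.
Qed.

(** In the argument of [psi], the pair [p] is matched iff [x qw (+) m = x (d v) (+) m], that is
    [x qw = x (d v)] for either [m]: the matching of [p] becomes the agreement of [w] with [v]. *)
Lemma ghz_on_grow T d v w p b m (psi psi' : state R Q) a :
  let qv := half p b in let qw := half p (~~ b) in
  anchored T d -> ghz_on T d psi -> v \in T -> w \notin T ->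
  holder qv = v -> holder qw = w ->
  (forall x, psi' x = a * ((~~ x qv)%:R *
     psi (set_bit (set_bit x qw (x qw (+) m)) qv (x (d v) (+) m)))) ->
  ghz_on (w |: T) (fun i => if i == w then qw else d i) psi'.
Proof.
move=> qv qw dT [a0 [B [B_garbage psiE]]] vT wT hqv hqw psi'E.
set d' := fun i => _; set T' := w |: T.
have sub_int p' : internal T p' -> internal T' p'.
  by rewrite /internal !in_setU1 => /andP[-> ->]; rewrite !orbT.
have sub_within q : within T q -> within T' q.
  by case: q => // -[p' b']; apply: sub_int.
have pT : ~~ internal T p by rewrite (internal_half T p b) hqw (negbTE wT) andbF.
have pT' : internal T' p.
  by rewrite (internal_half T' p b) hqv hqw !in_setU1 eqxx vT orbT.
have d'T i : i \in T -> d' i = d i.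
  by rewrite /d'; case: eqP => // -> /(negP wT).
have d'w : d' w = qw by rewrite /d' eqxx.
have d_half i p' b' : i \in T -> ~~ internal T p' -> d i != half p' b'.
  by move=> /dT[_ di] p'T; apply: contraTneq di => ->.
have half_garbage p' b' : ~~ internal T p' -> half p' b' != qw ->
    half p' b' \notin d' @: T'.
  move=> p'T p'qw; apply/imsetP => -[k]; rewrite in_setU1 => /orP[/eqP ->|kT].
    by rewrite d'w => /eqP; rewrite (negbTE p'qw).
  by rewrite d'T // => /esym/eqP; rewrite (negbTE (d_half _ _ _ _ _)).
have qvw : qv != qw by apply/eqP => -[]; case: (b).
(* The new predicate also records the reset of [qv] and the matching of the other pairs between [w]
   and [T], which have become internal. *)
exists (a * a0), (fun x => [&& ~~ x qv,
   matched [pred p' | [&& ~~ internal T p', p' != p & internal T' p']] x & B x]).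
split=> [x y xy|x].
  have -> : x qv = y qv by apply: xy => //; apply: half_garbage.
  congr [&& _, _ & _].
    apply: eq_forallb => p' /=; apply: implyb_id2l => /and3P[p'T p'p p'T'].
    by rewrite !xy //; apply: half_garbage => //; apply: contraNneq p'p => -[->].
  apply: B_garbage => q qT qd; apply: xy; first exact: sub_within.
  apply: contra qd => /imsetP[k]; rewrite in_setU1 => /orP[/eqP -> qE|kT ->].
    by move: qT; rewrite qE d'w /= (negbTE pT).
  by rewrite d'T ?imset_f.
rewrite psi'E psiE; set y := set_bit _ _ _.
have y_off q : q != qv -> q != qw -> y q = x q.
  by move=> qqv qqw; rewrite !ffunE (negbTE qqv) (negbTE qqw).
have yqv : y qv = x (d v) (+) m by rewrite ffunE eqxx.
have yqw : y qw = x qw (+) m.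
  by rewrite !ffunE eq_sym (negbTE qvw) eqxx.
have yd i : i \in T -> y (d i) = x (d i).
  by move=> iT; rewrite y_off ?d_half.
(* Only the two halves of [p] change, and [B] does not see them, as [p] leaves [T]. *)
have -> : B y = B x.
  apply: B_garbage => q qT _; apply: y_off; apply: contraTneq qT => ->;
  exact: pT.
have y_half p' b' : p' != p -> y (half p' b') = x (half p' b').
  by move=> p'p; apply: y_off; apply: contraNneq p'p => -[-> _].
rewrite -!mulrA; congr (_ * _); rewrite mulrCA; congr (_ * _).
rewrite -natrM mulnb; congr (_%:R); congr nat_of_bool.
apply/idP/idP => [/and4P[xqv ag mat Bx]|/and5P[ag mat xqv mat' Bx]].
  have xqw : x qw = x (d v).
    by apply: (@addIb m); rewrite -yqw -yqv; exact: (esym (matched_half b mat pT)).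
  apply/and5P; split=> //.
  - apply/forall_inP=> i iT'; apply/forall_inP=> j jT'.
    have xd k : k \in T' -> x (d' k) = x (d v).
      rewrite in_setU1 => /orP[/eqP ->|kT]; first by rewrite d'w.
      rewrite d'T // -!yd //.
      by apply/eqP; move/forall_inP: ag => /(_ k kT)/forall_inP; apply.
    by rewrite !xd.
  - apply/forall_inP=> p' p'T'; have p'p : p' != p.
      by apply: contraNneq p'T' => ->.
    rewrite -!y_half //; apply/eqP; apply: (matched_half false mat).
    by apply: contra p'T'; apply: sub_int.
  - apply/forall_inP=> p' /and3P[p'T p'p _].
    by rewrite -!y_half //; apply/eqP; apply: (matched_half false mat).
have x_ag i : i \in T' -> x (d' i) = x (d v).
  move=> iT'; rewrite -(d'T v) //; apply/eqP.
  by move/forall_inP: ag => /(_ i iT')/forall_inP; apply; rewrite in_setU1 vT orbT.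
have iT' i : i \in T -> i \in T' by rewrite in_setU1 => ->; rewrite orbT.
apply/and4P; split=> //.
  apply/forall_inP=> i iT; apply/forall_inP=> j jT.
  by rewrite !yd // -(d'T i) // -(d'T j) // !x_ag ?iT'.
apply/forall_inP=> p' p'T; have [->|p'p] := eqVneq p' p.
  have : y qv = y qw by rewrite yqv yqw -d'w x_ag // setU11.
  by rewrite /qv /qw; case: (b) => /= ->.
rewrite !y_half //; apply/eqP; have [p'T'|p'T'] := boolP (internal T' p').
  by apply: (matched_half false mat'); apply/and3P; split.
exact: (matched_half false mat).
Qed.

Lemma anchored_grow T d v w p b :
  let qv := half p b in let qw := half p (~~ b) in
  anchored T d -> v \in T -> holder qv = v -> holder qw = w ->
  anchored (w |: T) (fun i => if i == w then qw else d i).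
Proof.
move=> qv qw dT vT hqv hqw i; rewrite in_setU1; case: eqP => [-> _|_ /= /dT[di wi]].
  rewrite hqw /= (internal_half _ p b) hqv hqw !in_setU1 eqxx vT orbT.
  by [].
split=> //; case: (d i) wi => // -[p' b'] /=.
by rewrite /internal !in_setU1 => /andP[-> ->]; rewrite !orbT.
Qed.

(** During a round the last event is the one just recorded, so it can be read whatever the earlier
    memory; the defaults make the functions total. *)
Definition outcome_parity (mem : memory n) : bool :=
  if last (Outcome n 0) mem is Outcome o then odd o else false.

Definition message_bit (mem : memory n) : bool :=
  if last (Outcome n 0) mem is Message _ [:: m] then m else false.

Definition fuse_round v w (s s' : {q | @held_by n e anc v q})
    (r : {q | @held_by n e anc w q}) (ss' : s != s') : protocol R e anc :=
  [:: existT _ v (fun=> Measure (fuse_operators_complete R ss'));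
      existT _ v (fun mem => Send R e anc v w [:: outcome_parity mem]);
      existT _ w (fun mem => Unitary (flip_operator_unitary R r (message_bit mem)))].

(** Here [a] is the normalization factor of the measurement and [m] the parity of its outcome; since
    [ghz_on] leaves the scalar free, [a] need not be computed. *)
Lemma run_fuse_round v w s s' r ss' c c' :
  run (@fuse_round v w s s' r ss') c c' ->
  val r != val s -> val r != val s' ->
  exists a m, forall x, quantum c' x = a * ((~~ x (val s'))%:R * quantum c
    (set_bit (set_bit x (val r) (x (val r) (+) m)) (val s') (x (val s) (+) m))).
Proof.
move=> [c1 [[o [_ ->]] [c2 [-> [c3 [-> ->]]]]]] rs rs' /=.
rewrite /message_bit /record_event !eqxx !last_rcons /outcome_parity last_rcons.
eexists; exists (odd o) => x.
rewrite apply_flip ffunE apply_fuse.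
by rewrite !ffunE ![val s == _]eq_sym ![val s' == _]eq_sym (negbTE rs) (negbTE rs').
Qed.

Lemma run_cat (P P' : protocol R e anc) c c' :
  run (P ++ P') c c' -> exists2 c1, run P c c1 & run P' c1 c'.
Proof.
elim: P c => [|s P IH] c /=; first by exists c.
by move=> [c1 [step /IH[c2 ? ?]]]; exists c2 => //; exists c1.
Qed.

Definition preparable_on T := exists (P : protocol R e anc) d,
  anchored T d /\
  forall c, run P (initial_config R e anc) c -> ghz_on T d (quantum c).

Hypotheses (e_sym : symmetric e) (e_irr : irreflexive e).

(** The empty protocol suffices: an EPR pair is already a GHZ state on its two endpoints. *)
Lemma preparable_on_edge v w : e v w -> preparable_on [set v; w].
Proof.
move=> vw; have [p [b [hv hw]]] := edge_halves e_sym e_irr vw.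
pose d i := if i == v then half p b else half p (~~ b).
have neq_vw : w != v by apply: contraTneq vw => ->; rewrite e_irr.
(* Edges are stored in increasing order, so the endpoints determine [p]. *)
have internal_vw p' : internal [set v; w] p' = (p' == p).
  apply/idP/eqP => [|->]; last first.
    by rewrite (internal_half _ p b) hv hw !inE !eqxx orbT.
  case: p p' {d} hv hw => [[i j] ij] [[k l] kl] /= hv hw.
  rewrite /internal !inE /= => kl_vw; apply/val_inj => /=.
  move/andP: ij => [/= ij _]; move/andP: kl => [/= kl _]; move: kl_vw ij kl.
  by case: b hv hw => /= -> ->; case/andP=> /orP[] /eqP -> /orP[] /eqP ->;
    rewrite ?ltnn // => lt1 lt2; move: (ltn_trans lt1 lt2); rewrite ltnn.
exists [::], d; split=> [i|c ->].
  rewrite !inE /d; case: eqP => [-> _|_ /= /eqP ->]; by rewrite ?hv ?hw /= internal_vw.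
exists (\prod_(p : edge e) (sqrtC 2)^-1), predT; split=> // x /=.
rewrite ffunE [X in _ * X]big1 => [|[i []] //]; rewrite mulr1 big_split.
congr (_ * _); rewrite andbT.
transitivity ([forall p, x (half p false) == x (half p true)]%:R : R[i]).
  have [/forallP all_eq|/forallPn[p' /negbTE neq]] :=
    boolP [forall p, x (half p false) == x (half p true)].
    by rewrite big1 // => p' _; rewrite all_eq.
  by rewrite (bigD1 p') //= neq mul0r.
congr (nat_of_bool _)%:R; have dv : d v = half p b by rewrite /d eqxx.
have dw : d w = half p (~~ b) by rewrite /d (negbTE neq_vw).
apply/forallP/andP => [xp|[ag mat] p'].
  split; last by apply/forall_inP=> p' _; apply: xp.
  have xvw : x (d v) = x (d w).
    by rewrite dv dw; move/eqP: (xp p); case: (b).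
  by apply/forall_inP=> i; rewrite !inE => /orP[] /eqP ->;
     apply/forall_inP=> j; rewrite !inE => /orP[] /eqP ->; rewrite ?xvw.
have [->|p'p] := eqVneq p' p; last first.
  by apply/eqP; apply: (matched_half false mat); rewrite /= internal_vw.
move/forall_inP/(_ v (set21 _ _))/forall_inP/(_ w (set22 _ _)): ag.
by rewrite dv dw; case: (b); rewrite // eq_sym.
Qed.

Lemma preparable_on_grow T v w :
  preparable_on T -> v \in T -> w \notin T -> e v w -> preparable_on (w |: T).
Proof.
move=> [P [d [dT PT]]] vT wT vw.
have [p [b [hv hw]]] := edge_halves e_sym e_irr vw.
have pT : ~~ internal T p by rewrite (internal_half T p b) hw (negbTE wT) andbF.
(* The qubit [d v] lies within [T] and [p] does not, so the fused qubits are distinct. *)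
have d_half b' : d v != half p b'.
  by have [_ dv] := dT v vT; apply: contraTneq dv => ->.
have heldd : held_by v (d v) by apply/eqP; case: (dT v vT).
have heldv : held_by v (half p b) by apply/eqP.
have heldw : held_by w (half p (~~ b)) by apply/eqP.
have neq : exist (held_by v) (d v) heldd != exist (held_by v) (half p b) heldv.
  by apply: contraNneq (d_half b) => /(congr1 val) /= /eqP.
exists (P ++ fuse_round (exist (held_by w) (half p (~~ b)) heldw) neq).
eexists; split; first exact: anchored_grow dT vT hv hw.
move=> c /run_cat[c1 /PT c1T /run_fuse_round[]] /=.
- by apply: contraNneq (d_half (~~ b)) => <-.
- by apply/eqP => -[]; case: (b).
- by move=> a [m cE]; apply: ghz_on_grow c1T vT wT hv hw cE.
Qed.

Lemma preparable_on_setT (i0 : 'I_n) : preparable_on setT -> locc_preparable e (ghz R n).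
Proof.
move=> [P [d [dT PT]]]; have dK i : holder (d i) = i by case: (dT i (in_setT i)).
exists anc, P, d; split=> // c /PT[a [B [B_garbage cE]]].
pose ext (z : bits {q | q \notin codom d}) : bits Q := overwrite [ffun=> false] z.
(* The factor [sqrtC 2] cancels the normalization of [ghz]. Designated qubits are filled with zeros,
   which [B] does not read. *)
exists [ffun z => a * sqrtC 2 * (B (ext z))%:R] => x.
rewrite cE [X in _ = _ * X]ffunE.
have -> : B (ext (restrict_bits (fun q => q \notin codom d) x)) = B x.
  apply: B_garbage => q _ qd.
  have {}qd : q \notin codom d.
    by apply: contra qd => /codomP[k ->]; apply: imset_f.
  by rewrite -[q]/(val (exist (fun q => q \notin codom d) q qd)) overwrite_in ffunE.
have -> : matched (predC (internal setT)) x.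
  by apply/forall_inP=> p; rewrite /= /internal !in_setT.
rewrite ghzE -[agree _ _ _ && _]/(agree setT d x && B x) -mulnb natrM.
set g := [ffun _ => _].
have -> : agree setT d x = (g == [ffun=> false]) || (g == [ffun=> true]) :> bool.
  apply/idP/orP => [ag|g_const].
    have x_const k : x (d k) = x (d i0).
      by apply/eqP; move/forall_inP: ag => /(_ k (in_setT k))/forall_inP; apply.
    by case xi0: (x (d i0)); [right|left]; apply/eqP/ffunP=> k;
       rewrite !ffunE x_const.
  have xg k : x (d k) = g k by rewrite ffunE.
  apply/forall_inP=> k _; apply/forall_inP=> l _; rewrite !xg.
  by case: g_const => /eqP ->; rewrite !ffunE.
rewrite -natrD.
(* The agent [i0] tells the two constant assignments apart, so the disjunction is a sum. *)
have -> : (((g == [ffun=> false]) || (g == [ffun=> true])) =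
    (g == [ffun=> false]) + (g == [ffun=> true]) :> nat)%N.
  case: eqP => // ->; case: eqP => // /ffunP/(_ i0).
  by rewrite !ffunE.
rewrite mulrACA; congr (_ * _).
by rewrite mulrC mulfK // sqrtC_eq0 pnatr_eq0.
Qed.

End Sufficiency.

(** * Exhausting a connected graph, and the equivalence *)

(** Otherwise [T] would be closed under edges, and a path from [v0] to [w0] could not leave it. *)
Lemma connected_boundary (n : nat) (e : rel 'I_n) (T : {set 'I_n}) v0 w0 :
  connected_graph e -> v0 \in T -> w0 \notin T ->
  exists v w, [/\ v \in T, w \notin T & e v w].
Proof.
move=> e_conn v0T w0T.
have [/existsP[v /existsP[w /and3P[]]]|closedT] :=
  boolP [exists v, exists w, [&& v \in T, w \notin T & e v w]].
  by exists v, w.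
have path_T s v : path e v s -> v \in T -> last v s \in T.
  elim: s v => //= w s IH v /andP[vw ws] vT; apply: IH ws _.
  apply: contraNT closedT => wT; apply/existsP; exists v; apply/existsP; exists w.
  by rewrite vT wT.
have /connectP[s ps w0E] := e_conn v0 w0.
by rewrite w0E path_T in w0T.
Qed.

Lemma connected_preparable (R : realType) (n : nat) (e : rel 'I_n) :
  (2 <= n)%N -> symmetric e -> irreflexive e -> connected_graph e ->
  locc_preparable e (ghz R n).
Proof.
move=> hn e_sym e_irr e_conn; pose i0 := Ordinal (ltnW hn).
pose i1 := Ordinal hn.
(* The second agent, available as [n] is at least 2, yields a first edge, leaving the singleton of
   [i0]. *)
have [|v [w [_ _ vw]]] := connected_boundary e_conn (set11 i0) (w0 := i1).
  by rewrite inE.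
suff prep_setT k T : #|~: T| = k -> v \in T -> preparable_on R e T ->
    preparable_on R e setT.
  apply: (preparable_on_setT i0).
  exact: prep_setT erefl (set21 v w) (preparable_on_edge R e_sym e_irr vw).
(* Induction on the number of agents outside [T]; [v] keeps [T] nonempty. *)
elim/ltn_ind: k T => k IH T Tk vT prepT; case: (set_0Vmem (~: T)) => [T0|[u]].
  by rewrite -[setT]setC0 -T0 setCK.
rewrite inE => uT; have [a [b [aT bT ab]]] := connected_boundary e_conn vT uT.
apply: (IH _ _ (b |: T) erefl); last exact: preparable_on_grow aT bT ab.
  rewrite -Tk setCU setIC -setDE [X in (_ < X)%N](cardsD1 b).
  by rewrite inE bT.
by rewrite in_setU1 vT orbT.
Qed.

Theorem theorem3p3 (R : realType) (n : nat) (hn : (2 <= n)%N) (e : rel 'I_n)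
    (e_sym : symmetric e) (e_irr : irreflexive e) :
  (exists t : state R 'I_n, maximally_entangled t /\ locc_preparable e t)
  <-> connected_graph e.
Proof.
split=> [[t [t_max t_prep]]|e_conn]; first exact: preparable_connected t_max t_prep.
exists (ghz R n); split; first exact: ghz_maximally_entangled.
exact: connected_preparable.
Qed.
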